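(* Let $o\in\mathbb{E}^{d}$ and let $\mathcal{I}$ be a family of possibly degenerate compact line-segments $I\subseteq\mathbb{E}^{d}$ such that $I\in\mathcal{I}$ implies that $I\subseteq r_{I}\setminus\{o\}$ with $r_{I}$ some ray emanating from $o$. If for any $(d+1)$-element set $\mathcal{K}\subseteq\mathcal{I}$ we have $\mathcal{H}_{\mathcal{K}}\neq\emptyset$, then $\mathcal{H}_{\mathcal{I}}\neq\emptyset$. That is, if for any $(d+1)$-element set $\mathcal{K}\subseteq\mathcal{I}$ there exists a hyperplane $H\in\mathcal{H}$ that intersects any line-segment $I\in\mathcal{K}$, then there exists a hyperplane $H\in\mathcal{H}$ that intersects any line-segment $I\in\mathcal{I}$ (in a single point $p_{I}$).
   Context: $\mathbb{E}^{d}$ denotes $d$-dimensional Euclidean space. For the fixed point $o\in\mathbb{E}^{d}$, $\mathcal{H}$ denotes the space of all hyperplanes $H\subseteq\mathbb{E}^{d}$ with $o\notin H$. For a family $\mathcal{M}$ of subsets of $\mathbb{E}^{d}$, $\mathcal{H}_{\mathcal{M}}:=\{H\in\mathcal{H}\mid M\cap H\neq\emptyset \text{ for all } M\in\mathcal{M}\}$. A compact line-segment is a set $[a,b]=\operatorname{conv}\{a,b\}$ with $a,b\in\mathbb{E}^{d}$; it is degenerate if $a=b$, i.e. if it is a single point.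
   Formalization: The family of line-segments is assumed to have at least d+1 members; with fewer the hypothesis on (d+1)-element sets is vacuous and the claim fails for d ≥ 2, e.g. for the two degenerate segments {o+v} and {o−v}. *)

(* Defs.v *)
From HB Require Import structures.
From mathcomp Require Import all_boot all_order all_algebra.
From mathcomp Require Import boolp classical_sets functions cardinality reals.
From mathcomp Require Import convex.

Set Implicit Arguments.
Unset Strict Implicit.
Unset Printing Implicit Defensive.

Import Order.TTheory GRing.Theory Num.Theory.
Local Open Scope classical_set_scope.
Local Open Scope ring_scope.

(* E^d is modelled by 'rV[R]_d with its standard inner product. *)

Definition dot (R : realType) (d : nat) (u x : 'rV[R]_d) : R :=
  \sum_(i < d) u 0 i * x 0 i.

Definition is_hyperplane (R : realType) (d : nat) (H : set 'rV[R]_d) : Prop :=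
  exists2 u : 'rV[R]_d, u != 0 & exists c : R, H = [set x | dot u x = c].

Definition hyperplanes_avoiding (R : realType) (d : nat) (o : 'rV[R]_d) :
    set (set 'rV[R]_d) :=
  [set H | is_hyperplane H /\ ~ H o].

Definition transversals (R : realType) (d : nat) (o : 'rV[R]_d)
    (M : set (set 'rV[R]_d)) : set (set 'rV[R]_d) :=
  [set H | hyperplanes_avoiding o H /\
           forall A, M A -> (A `&` H) !=set0].

Definition convex_hull (R : realType) (d : nat) (A : set 'rV[R]_d) :
    set 'rV[R]_d :=
  smallest (@convex_set R 'rV[R]_d) A.

(* a = b is allowed: degenerate segments are single points. *)
Definition is_segment (R : realType) (d : nat) (S : set 'rV[R]_d) : Prop :=
  exists a b : 'rV[R]_d, S = convex_hull [set a; b].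

Definition is_ray_from (R : realType) (d : nat) (o : 'rV[R]_d)
    (r : set 'rV[R]_d) : Prop :=
  exists2 v : 'rV[R]_d, v != 0 & r = [set o + t *: v | t in [set t : R | 0 <= t]].

(* Main.v *)
Require Import Defs.
From mathcomp Require Import all_boot all_order all_algebra finmap.
From mathcomp Require Import boolp classical_sets functions cardinality reals.
From mathcomp Require Import interval_inference convex topology normedtype.
From mathcomp Require Import ring lra.

(* A hyperplane avoiding o is {x | <u, x - o> = 1} for a unique u != 0, and it
   meets the segment {o + t w | lo <= t <= hi} iff 1/hi <= <u, w> <= 1/lo. So the
   transversals of F correspond to the points common to a family of closed slabs
   in the dual space. Helly's theorem, via Radon's partition, gives common points
   for finite subfamilies. Slabs are unbounded, but a finite subfamily whose
   normals span all the normals bounds every coordinate that matters, and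
   compactness of a box settles the infinite family. *)

Set Implicit Arguments.
Unset Strict Implicit.
Unset Printing Implicit Defensive.

Import Order.TTheory GRing.Theory Num.Theory numFieldNormedType.Exports.
Local Open Scope classical_set_scope.
Local Open Scope card_scope.
Local Open Scope ring_scope.

(** * Bilinearity and continuity of the inner product *)

Section Dot.
Context (R : realType) (d : nat).
Implicit Types u x y : 'rV[R]_d.

Lemma dotE u x : dot u x = (u *m x^T) 0 0.
Proof. by rewrite mxE; apply: eq_bigr => i _; rewrite mxE. Qed.

Lemma dotC u x : dot u x = dot x u.
Proof. by apply: eq_bigr => i _; rewrite mulrC. Qed.

Lemma dotDr u x y : dot u (x + y) = dot u x + dot u y.
Proof. by rewrite !dotE linearD mulmxDr mxE. Qed.

Lemma dotZr u t x : dot u (t *: x) = t * dot u x.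
Proof. by rewrite !dotE linearZ -scalemxAr mxE. Qed.

Lemma dotBr u x y : dot u (x - y) = dot u x - dot u y.
Proof. by rewrite dotDr -scaleN1r dotZr mulN1r. Qed.

Lemma dotZl u t x : dot (t *: u) x = t * dot u x.
Proof. by rewrite dotC dotZr dotC. Qed.

Lemma dot0l x : dot 0 x = 0 :> R.
Proof. by rewrite -(scale0r (0 : 'rV[R]_d)) dotZl mul0r. Qed.

Lemma dot_continuous u : continuous (dot u).
Proof.
have -> : dot u = \sum_(i < d) (fun x : 'rV[R]_d => u 0 i * x 0 i).
  by apply/funext => x; rewrite fct_sumE.
elim/big_ind: _ => [|f g cf cg|i _] x.
  exact: (@cst_continuous _ _ (0 : R)).
  by apply: continuousD; [exact: cf|exact: cg].
by apply: continuousM; [exact: cst_continuous|exact: (@coord_continuous R)].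
Qed.

End Dot.

Lemma dot_mulmxl (R : realType) m n (y : 'rV[R]_m) (Q : 'M_(m, n)) x :
  dot (y *m Q) x = dot y (x *m Q^T).
Proof. by rewrite !dotE trmx_mul trmxK mulmxA. Qed.

(** * Convex sets and finite convex combinations *)

Section Convexity.
Context (R : realType) (V : lmodType R).
Implicit Types A : set V.

Lemma convex_setP A : @convex_set R V A <->
  forall x y (t : R), A x -> A y -> 0 <= t <= 1 -> A (t *: x + (1 - t) *: y).
Proof.
split=> [cA x y t Ax Ay /andP[t0 t1]|cA x y t].
  have := cA x y (Itv01 t0 t1); rewrite !inE; exact.
rewrite !inE => Ax Ay; apply: cA => //.
by apply/andP; split; [exact: ge0|exact: le1].
Qed.

Lemma convex_set_sum A (I : eqType) (s : seq I) (P : pred I) (w : I -> R)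
    (x : I -> V) :
    @convex_set R V A -> (forall i, 0 <= w i) -> (forall i, P i -> A (x i)) ->
    \sum_(i <- s | P i) w i = 1 ->
  A (\sum_(i <- s | P i) w i *: x i).
Proof.
move=> /convex_setP cA w0 Ax w1.
(* Without normalising the weights the claim survives induction on s. *)
suff main : 0 < \sum_(i <- s | P i) w i ->
    A ((\sum_(i <- s | P i) w i)^-1 *: \sum_(i <- s | P i) w i *: x i).
  by have := main; rewrite w1 invr1 scale1r; apply.
elim: s {w1} => [|i s IHs]; first by rewrite big_nil ltxx.
rewrite !big_cons; case: ifP => // Pi.
set W := \sum_(j <- s | P j) w j in IHs *.
set X := \sum_(j <- s | P j) w j *: x j in IHs *.
have : 0 <= W by exact: sumr_ge0.
rewrite le_eqVlt => /predU1P[W0|W_gt0] wW_gt0.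
  (* Nonnegative weights with sum 0 all vanish, so [X] drops out and only [x i] remains. *)
  have -> : X = 0.
    apply: big1_seq => j /andP[Pj js].
    have /allP/(_ _ js) : all (fun k => P k ==> (w k == 0)) s.
      by rewrite -psumr_eq0// -/W -W0.
    by rewrite Pj => /eqP ->; rewrite scale0r.
  rewrite -W0 !addr0 in wW_gt0 *.
  by rewrite scalerA mulVf ?scale1r ?lt0r_neq0//; exact: Ax.
have -> : (w i + W)^-1 *: (w i *: x i + X) =
    (w i / (w i + W)) *: x i + (1 - w i / (w i + W)) *: (W^-1 *: X).
  rewrite scalerDr !scalerA; congr (_ *: _ + _ *: _); field.
    exact: lt0r_neq0.
  by rewrite !lt0r_neq0.
apply: cA; [exact: Ax|exact: IHs|].
by rewrite ler_pdivrMr// mul1r lerDl (ltW W_gt0) divr_ge0// ltW.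
Qed.

End Convexity.

(** * Radon's partition and Helly's theorem for finite families *)

Section Helly.
Context (R : realType) (d : nat).

(** More than d + 1 points are affinely dependent; splitting a dependence by the sign of its
    coefficients and normalising gives two equal convex combinations. *)
Lemma radon n (p : 'I_n -> 'rV[R]_d) : (d.+1 < n)%N ->
  exists (S : {set 'I_n}) (w : 'I_n -> R),
    [/\ forall k, 0 <= w k,
        \sum_(k in S) w k = 1, \sum_(k | k \notin S) w k = 1 &
        \sum_(k in S) w k *: p k = \sum_(k | k \notin S) w k *: p k].
Proof.
move=> dn.
(* The column of ones forces the coefficients of a left kernel vector [l] to sum to 0. *)
pose M : 'M[R]_(n, 1 + d) := row_mx (const_mx 1) (\matrix_k p k).
have /rowV0Pn[l /sub_kermxP] : kermx M != 0.
  rewrite -mxrank_eq0 mxrank_ker -lt0n subn_gt0.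
  exact: leq_ltn_trans (rank_leq_col _) dn.
rewrite mul_mx_row -(row_mx0 _ 1 1 d) => /eq_row_mx[l_sum l_comb] l_neq0.
have {}l_sum : \sum_k l 0 k = 0.
  move/matrixP/(_ 0 0): l_sum; rewrite !mxE => l0; rewrite -[RHS]l0.
  by apply: eq_bigr => k _; rewrite mxE mulr1.
have {}l_comb : \sum_k l 0 k *: p k = 0.
  by rewrite -[RHS]l_comb mulmx_sum_row; apply: eq_bigr => k _; rewrite rowK.
pose S := [set k | 0 < l 0 k]%SET.
have absS k : k \in S -> `|l 0 k| = l 0 k.
  by rewrite inE => lk; rewrite ger0_norm// ltW.
have absSC k : k \notin S -> `|l 0 k| = - l 0 k.
  by rewrite inE -leNgt => lk; rewrite ler0_norm.
have splitS (W : zmodType) (f : 'I_n -> W) :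
    \sum_(k in S) f k + \sum_(k | k \notin S) f k = \sum_k f k.
  by rewrite [RHS](bigID (mem S)).
pose P := \sum_(k in S) `|l 0 k|.
have PE : P = \sum_(k | k \notin S) `|l 0 k|.
  apply/eqP; rewrite -subr_eq0 /P (eq_bigr _ absS) (eq_bigr _ absSC) sumrN.
  by rewrite opprK splitS l_sum.
(* If [P] were 0, the negative part of [l] would vanish too, hence all of [l]. *)
have P_gt0 : 0 < P.
  rewrite lt_neqAle sumr_ge0// andbT eq_sym; apply: contra l_neq0 => /eqP P0.
  have : \sum_k `|l 0 k| == 0.
    by rewrite -splitS -PE -/P P0 addr0.
  rewrite psumr_eq0// => /allP l0; apply/eqP/rowP => k; rewrite mxE.
  by have /= := l0 k (mem_index_enum k); rewrite normr_eq0 => /eqP.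
exists S, (fun k => `|l 0 k| / P); split.
- by move=> k; rewrite divr_ge0// ltW.
- by rewrite -mulr_suml divff// lt0r_neq0.
- by rewrite -mulr_suml -PE divff// lt0r_neq0.
apply/eqP; rewrite -subr_eq0 -sumrN.
rewrite [X in X + _](_ : _ = \sum_(k in S) P^-1 *: (l 0 k *: p k)); last first.
  by apply: eq_bigr => k /absS ->; rewrite scalerA mulrC.
rewrite [X in _ + X](_ : _ = \sum_(k | k \notin S) P^-1 *: (l 0 k *: p k));
    last first.
  by apply: eq_bigr => k /absSC ->; rewrite scalerA mulNr scaleNr opprK mulrC.
by rewrite splitS -scaler_sumr l_comb scaler0.
Qed.

(** Induction on the length: dropping each position in turn yields one point per position, and
    Radon's partition of these points gives the common point. *)
Lemma helly_seq (T : eqType) (A : T -> set 'rV[R]_d) :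
    (forall i, @convex_set R 'rV[R]_d (A i)) ->
    (forall t : seq T, (size t <= d.+1)%N -> exists x, {in t, forall i, A i x}) ->
  forall s : seq T, exists x, {in s, forall i, A i x}.
Proof.
move=> cA small s; have [n] := ubnP (size s); elim: n s => // n IHn s.
rewrite ltnS => s_le_n; have [|d_lt_s] := leqP (size s) d.+1; first exact: small.
pose f := tnth (in_tuple s).
have /choice[p pA] (k : 'I_(size s)) :
    exists x, forall j, j != k -> A (f j) x.
  have [|x xA] := IHn [seq f j | j in predC1 k].
    by rewrite size_image cardC1 card_ord prednK// (leq_trans _ d_lt_s).
  by exists x => j jk; apply/xA/fintype.image_f.
have [S [w [w_ge0 wS wSC eq_q]]] := radon p d_lt_s.
exists (\sum_(k in S) w k *: p k) => i /(tnthP (in_tuple s))[j ->].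
(* The set at position [j] contains every [p k] with [k != j], so the point is written using the
   side of the partition that omits [j]. *)
have [jS|jS] := boolP (j \in S).
  rewrite eq_q; apply: convex_set_sum => // k kS; apply: pA.
  by apply: contraNneq kS => <-.
by apply: convex_set_sum => // k kS; apply: pA; apply: contraNneq jS => ->.
Qed.

End Helly.

(** * Helly's theorem for arbitrary families of slabs *)

Section Slabs.
Context (R : realType) (d : nat).

(** A list of maximal rank works: one more vector cannot raise the rank, so it already lies in the
    row space. *)
Lemma spanning_seq (K : fieldType) (T : Type) (v : T -> 'rV[K]_d) :
  exists s : seq T,
    forall i, (v i <= \matrix_(k < size s) v (tnth (in_tuple s) k))%MS.
Proof.
pose B s := \matrix_(k < size s) v (tnth (in_tuple s) k).
pose P n := `[< exists s, \rank (B s) = n >].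
have exP : exists n, P n by exists (\rank (B [::])); apply/asboolP; exists [::].
have leP n : P n -> (n <= d)%N by case/asboolP => s <-; exact: rank_leq_col.
case: (ex_maxnP exP leP) => n /asboolP[s rs] maxn; exists s => i.
have BS : (B s <= B (i :: s))%MS.
  apply/row_subP => k; rewrite rowK; apply/submxP.
  exists (delta_mx 0 (lift ord0 k)).
  by rewrite -rowE rowK !(tnth_nth i).
apply: (submx_trans (B := B (i :: s))).
  apply/submxP; exists (delta_mx 0 ord0).
  by rewrite -rowE rowK (tnth_nth i).
rewrite -(mxrank_leqif_sup BS) eqn_leq mxrankS//= rs.
by apply: maxn; apply/asboolP; exists (i :: s).
Qed.

Lemma helly_slabs (T : choiceType) (v : T -> 'rV[R]_d) (a b : T -> R) :
    (forall t : seq T, (size t <= d.+1)%N ->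
       exists u, {in t, forall i, a i <= dot u (v i) <= b i}) ->
  exists u, forall i, a i <= dot u (v i) <= b i.
Proof.
move=> small.
have {small} finite (t : seq T) :
    exists u, {in t, forall i, a i <= dot u (v i) <= b i}.
  apply: (helly_seq (A := fun i => [set u | a i <= dot u (v i) <= b i])) => //.
  move=> i; apply/convex_setP => x y l /= /andP[ax xb] /andP[ay yb].
  move=> /andP[l0 l1].
  by rewrite dotC dotDr !dotZr ![dot (v i) _]dotC; apply/andP; split; nra.
have [s s_span] := spanning_seq v.
pose e k := tnth (in_tuple s) k.
pose M := \matrix_(k < size s) v (e k).
(* The linear functional u only matters through its values y = u *m M^T on the
   spanning vectors, and these range over a compact box. *)
pose Q := pinvmx M^T.
pose box := [set y : 'rV[R]_(size s) |
  forall k, [set z | a (e k) <= z <= b (e k)] (y 0 k)].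
pose g i := [set y | a i <= dot (y *m Q) (v i) <= b i].
(* Each [v i] is a combination of rows of [M], so any vector with the same values as [u] on those
   rows has the same product with [v i]. *)
have QE (u : 'rV[R]_d) i : dot (u *m M^T *m Q) (v i) = dot u (v i).
  have /submxP[c ->] : (v i <= M)%MS by exact: s_span.
  have MQM : u *m M^T *m Q *m M^T = u *m M^T by apply/mulmxKpV/submxMl.
  by rewrite -(trmxK M) -!dot_mulmxl trmxK MQM.
have valE (u : 'rV[R]_d) k : (u *m M^T) 0 k = dot u (v (e k)).
  by rewrite mxE; apply: eq_bigr => i _; rewrite !mxE.
have itvE (x y : R) : [set z | x <= z <= y] = `[x, y]%classic.
  by apply/seteqP; split=> z /=; rewrite in_itv.
have cbox : compact box.
  apply: (rV_compact (A := fun k => [set z | a (e k) <= z <= b (e k)])) => k.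
  by rewrite itvE; exact: segment_compact.
have [y yP] : \bigcap_(i in [set: T]) (box `&` g i) !=set0.
  rewrite compact_In0 in cbox; apply: cbox.
    exists g => // i _.
    have -> : g i = dot (v i *m Q^T) @^-1` `[a i, b i]%classic.
      rewrite -itvE; apply/seteqP; split => y /=;
        by rewrite /g /= [dot (y *m Q) _]dot_mulmxl dotC.
    apply: preimage_closed; last exact: itv_closed.
    by move=> y _; exact: dot_continuous.
  (* Including [s] in the finite subfamily puts the values of [u] in the box. *)
  move=> t _; have [u uP] := finite (s ++ finmap.enum_fset t).
  exists (u *m M^T) => i /= it; split.
    by move=> k /=; rewrite valE uP// mem_cat mem_tnth.
  by rewrite /g /= QE uP// mem_cat it orbT.
by exists (y *m Q) => i; have [] := yP i.
Qed.

End Slabs.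

(** * Segments on rays as slab conditions on normalised hyperplanes *)

Section SegmentsOnRays.
Context (R : realType) (d : nat).
Implicit Types (o u w : 'rV[R]_d) (S H : set 'rV[R]_d).

(** Avoiding [o] means that [c - dot w o] is nonzero, so [w] can be divided by it. *)
Lemma hyperplanes_avoidingP o H : hyperplanes_avoiding o H <->
  exists2 u, u != 0 & H = [set x | dot u (x - o) = 1].
Proof.
split=> [[[w w_neq0 [c ->]] /= oc]|[u u_neq0 ->]].
  have k_neq0 : c - dot w o != 0.
    by rewrite subr_eq0; apply/eqP => coE; apply: oc.
  exists ((c - dot w o)^-1 *: w).
    by rewrite scaler_eq0 invr_eq0 negb_or k_neq0.
  apply/seteqP; split=> x /=; rewrite dotZl dotBr.
    by move=> ->; rewrite mulVf.
  by move/(canRL (mulVKf k_neq0)); rewrite mulr1 => /addIr.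
split; last by rewrite /= subrr dotC dot0l => /eqP; rewrite eq_sym oner_eq0.
exists u => //; exists (1 + dot u o).
apply/seteqP; split=> x /=; rewrite dotBr; first by move/(canRL (subrK _)).
by move=> ->; rewrite addrK.
Qed.

Lemma conv_on_ray o w (l x y : R) :
  l *: (o + x *: w) + (1 - l) *: (o + y *: w) = o + (l * x + (1 - l) * y) *: w.
Proof.
by rewrite !scalerDr addrACA !scalerA -!scalerDl [l + _]addrC subrK scale1r.
Qed.

(** The endpoints lie on the ray away from [o], so their parameters are positive; these, in
    increasing order, are [lo] and [hi]. *)
Lemma segment_on_rayE o r S : is_segment S -> is_ray_from o r -> S `<=` r `\ o ->
  exists w lo hi, [/\ 0 < lo, lo <= hi &
    S = [set o + t *: w | t in [set t : R | lo <= t <= hi]]].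
Proof.
move=> [a [b ->]] [w w_neq0 ->] hull_ray.
have hull_sub : [set a; b] `<=` convex_hull [set a; b] by exact: sub_smallest.
have on_ray x : [set a; b] x -> exists2 t, 0 < t & x = o + t *: w.
  move=> /hull_sub/hull_ray[[t /= t0 <-] tx]; exists t => //.
  rewrite lt_neqAle t0 andbT; apply/eqP => t0E; apply: tx.
  by rewrite /= -t0E scale0r addr0.
have {on_ray} [[s s_gt0 aE] [t t_gt0 bE]] := (on_ray a (or_introl erefl),
  on_ray b (or_intror erefl)).
wlog st : a b s t s_gt0 t_gt0 aE bE {hull_ray hull_sub} / s <= t.
  move=> wlg; have [st|/ltW ts] := leP s t; first exact: (wlg a b s t).
  by rewrite setUC; exact: (wlg b a t s).
exists w, s, t; split => //; apply/seteqP; split.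
  apply: smallest_sub.
    apply/convex_setP => _ _ l [x /andP[sx xt] <-] [y /andP[sy yt] <-].
    move=> /andP[l0 l1].
    exists (l * x + (1 - l) * y); first by apply/andP; split; nra.
    by rewrite conv_on_ray.
  move=> _ [->|->]; first by exists s; rewrite //= lexx.
  by exists t; rewrite //= lexx andbT.
move=> _ [x /= /andP[sx xt] <-] A [/convex_setP cA abA].
have [Aa Ab] : A a /\ A b by split; apply: abA; [left|right].
have [st0|st0] := eqVneq t s.
  by have -> : x = s by [lra]; rewrite -aE.
have ts_gt0 : 0 < t - s by rewrite subr_gt0 lt_neqAle eq_sym st0.
(* The solution of [l * s + (1 - l) * t = x]. *)
pose l := (t - x) / (t - s).
have -> : o + x *: w = l *: a + (1 - l) *: b.
  rewrite aE bE conv_on_ray; congr (_ + _ *: _).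
  by rewrite /l; field; exact: lt0r_neq0.
apply: cA => //; rewrite /l divr_ge0 ?subr_ge0//=.
by rewrite ler_pdivrMr// mul1r lerD2l lerN2.
Qed.

(** The hyperplane meets the line at the parameter inverse to [dot u w], and inversion reverses
    order on positive numbers. *)
Lemma ray_segment_transversalP o u w (lo hi : R) : 0 < lo -> lo <= hi ->
  [set o + t *: w | t in [set t : R | lo <= t <= hi]] `&`
    [set x | dot u (x - o) = 1] !=set0 <->
  hi^-1 <= dot u w <= lo^-1.
Proof.
move=> lo_gt0 lo_hi; have hi_gt0 := lt_le_trans lo_gt0 lo_hi.
split=> [[_ [[t /= /andP[lot thi] <-] /=]]|/andP[hiu ulo]].
  have t_gt0 := lt_le_trans lo_gt0 lot.
  rewrite addrC addKr dotZr => /(canRL (mulKf (lt0r_neq0 t_gt0))).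
  by rewrite mulr1 => ->; rewrite !lef_pV2 ?posrE// thi.
have u_gt0 : 0 < dot u w by apply: lt_le_trans hiu; rewrite invr_gt0.
exists (o + (dot u w)^-1 *: w); split => /=.
  exists (dot u w)^-1 => //=.
  by rewrite -[lo]invrK -[hi]invrK !lef_pV2 ?posrE ?invr_gt0// ulo.
by rewrite addrC addKr dotZr mulVf// lt0r_neq0.
Qed.

End SegmentsOnRays.

(** * From the Helly hypothesis to the common transversal *)

(** Bridges short lists, possibly with repetitions, and the sets of exactly d + 1 members in the
    Helly hypothesis. *)
Lemma card_ge_extend (T : pointedType) (F : set T) n (t : seq T) :
    `I_n #<= F -> (forall x, x \in t -> F x) -> (size t <= n)%N ->
  exists K : set T, [/\ K `<=` F, K #= `I_n & forall x, x \in t -> K x].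
Proof.
move=> /ppcard_leP[f] tF t_le_n.
pose M := map f (iota 0 n); pose L := [seq x <- M | x \notin undup t].
have M_uniq : uniq M.
  rewrite map_inj_in_uniq ?iota_uniq// => x y; rewrite !mem_iota !add0n /=.
  by move=> xn yn; apply: inj; rewrite inE.
have t_le : (size (undup t) <= n)%N := leq_trans (size_undup t) t_le_n.
(* [M] has [n] distinct entries, and filtering removes at most [size (undup t)] of them. *)
have L_ge : (n - size (undup t) <= size L)%N.
  have size_M : size M = n by rewrite size_map size_iota.
  rewrite leq_subLR -{1}size_M -(count_predC (mem (undup t)) M) size_filter.
  rewrite leq_add2r -size_filter uniq_leq_size ?filter_uniq// => x.
  by rewrite mem_filter => /andP[].
pose s := undup t ++ take (n - size (undup t)) L.
have s_uniq : uniq s.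
  rewrite cat_uniq undup_uniq take_uniq ?filter_uniq// andbT.
  by apply/hasPn => x /mem_take; rewrite mem_filter => /andP[].
have inK x : [set` seq_fset tt s] x <-> x \in s by rewrite -(seq_fsetE tt s).
exists [set` seq_fset tt s]; split.
- move=> x /inK; rewrite mem_cat mem_undup => /orP[/tF//|/mem_take].
  rewrite mem_filter => /andP[_ /mapP[k]]; rewrite mem_iota => /andP[_ kn] ->.
  exact: funS.
- apply/card_eq_fsetP; rewrite size_seq_fset undup_id// size_cat.
  by rewrite size_takel// subnKC.
- by move=> x xt; apply/inK; rewrite mem_cat mem_undup xt.
Qed.

(* That F has at least d + 1 members is implicit in "for any
   (d+1)-element set K": without it the Helly hypothesis may be vacuous, and for
   d >= 2 two segments on opposite rays from o have no common transversal
   avoiding o. *)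
Theorem theoremB9 (R : realType) (d : nat) (o : 'rV[R]_d)
    (F : set (set 'rV[R]_d))
    (F_segment : forall S, F S -> is_segment S)
    (F_ray : forall S, F S ->
       exists2 r : set 'rV[R]_d, is_ray_from o r & S `<=` r `\ o)
    (F_card : `I_d.+1 #<= F)
    (F_helly : forall K : set (set 'rV[R]_d),
       K `<=` F -> K #= `I_d.+1 -> transversals o K !=set0) :
  exists2 H : set 'rV[R]_d, transversals o F H &
    forall S, F S -> exists p : 'rV[R]_d, S `&` H = [set p].
Proof.
pose seg (w : 'rV[R]_d) (lo hi : R) :=
  [set o + t *: w | t in [set t : R | lo <= t <= hi]].
have /choice[g gP] (S : F) : exists g : 'rV[R]_d * (R * R),
    [/\ 0 < g.2.1, g.2.1 <= g.2.2 & val S = seg g.1 g.2.1 g.2.2].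
  have FS := set_valP S; have [r o_r Sr] := F_ray _ FS.
  have [w [lo [hi [? ? ?]]]] := segment_on_rayE (F_segment _ FS) o_r Sr.
  by exists (w, (lo, hi)).
have [t t_le|u uP] := helly_slabs (v := fun S : F => (g S).1)
    (a := fun S => (g S).2.2^-1) (b := fun S => (g S).2.1^-1).
  have [||K [KF K_card tK]] := card_ge_extend (t := map val t) F_card.
  - by move=> _ /mapP[S _ ->]; exact: set_valP.
  - by rewrite size_map.
  have [_ [/hyperplanes_avoidingP[u _ ->] meets]] := F_helly _ KF K_card.
  exists u => S St; have [lo_gt0 lo_hi SE] := gP S.
  apply/(ray_segment_transversalP o) => //; rewrite -/(seg _ _ _) -SE.
  by apply/meets/tK/map_f.
(* A member of [F] is what makes [u] nonzero: its slab has a positive lower bound. *)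
have [S0 FS0] : F !=set0.
  apply/set0P; apply: contraL F_card => /eqP ->; rewrite card_le0.
  by apply/set0P; exists 0%N.
have u_gt0 (S : F) : 0 < dot u (g S).1.
  have [lo_gt0 lo_hi _] := gP S; have /andP[+ _] := uP S.
  by apply: lt_le_trans; rewrite invr_gt0 (lt_le_trans lo_gt0).
have meets S : F S -> (S `&` [set x | dot u (x - o) = 1]) !=set0.
  move=> FS; have [lo_gt0 lo_hi /= ->] := gP (SigSub (mem_set FS)).
  exact/ray_segment_transversalP.
exists [set x | dot u (x - o) = 1].
  split=> //; apply/hyperplanes_avoidingP; exists u => //.
  have := u_gt0 (SigSub (mem_set FS0)); apply: contraTneq => ->.
  by rewrite dot0l ltxx.
move=> S FS; have [p [Sp Hp]] := meets S FS; exists p.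
apply/seteqP; split=> [q [Sq Hq]|_ ->//].
move: Sp Hp Sq Hq; have := gP (SigSub (mem_set FS)).
(* Uniqueness: both parameters have product 1 with the same positive number [dot u w]. *)
move: (u_gt0 (SigSub (mem_set FS))) => {}u_gt0 [_ _ /= ->].
move=> [s _ <-] /= + [t _ <-] /=; rewrite ![o + _]addrC !addrK !dotZr.
by move=> <- /(mulIf (lt0r_neq0 u_gt0)) ->.
Qed.
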